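(* Fix a node $u$ with $d_u\ge 1$ neighbors, let $\eta>0$, $\alpha>0$, $\rho\in(0,1)$, and let $\Theta$ be a finite set of models, each $\theta\in\Theta$ determining embeddings with $\|\mathrm{E}_w\|_2=1$ for every node $w$. For $\theta\in\Theta$ and $v\in\mathcal{N}(u)$ let $h(u,v;\theta)=\mathrm{E}_u^\top\mathrm{E}_u+d_u\,g(u,v;\theta)$, let $P_{u,\theta}^*(v)=P_u(v)\exp(g(u,v;\theta)/\alpha)/\mathbb{E}_{w\sim P_u}[\exp(g(u,w;\theta)/\alpha)]$, and assume that for every $\theta\in\Theta$, $P^*_{u,\theta}$ maximizes $\mathbb{E}_{v\sim P}[h(u,v;\theta)]$ over all distributions $P$ on $\mathcal{N}(u)$ with $D_{KL}(P,P_u)\le\eta$ (i.e. $\alpha$ is the optimal Lagrange multiplier of the constraint). Put $\mathcal{L}_{DRO\_smooth}(u;\theta)=\mathbb{E}_{v\sim P^*_{u,\theta}}[h(u,v;\theta)]$. Let $P_u^{ideal}$ be a distribution on $\mathcal{N}(u)$ with $D_{KL}(P_u^{ideal},P_u)\le\eta$ and $\mathcal{L}_{ideal}(u;\theta)=\mathbb{E}_{v\sim P_u^{ideal}}[h(u,v;\theta)]$. Let $X_1,\dots,X_{d_u}$ be independent random variables and for each $\theta\in\Theta$ let $\widetilde{\mathcal{L}}_{DRO\_smooth}(u;\theta)=f_\theta(X_1,\dots,X_{d_u})$ be an estimator with $\mathbb{E}[f_\theta(X_1,\dots,X_{d_u})]=\mathcal{L}_{DRO\_smooth}(u;\theta)$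 such that changing any single coordinate $X_i$ changes $f_\theta$ by at most $\max_{v\in\mathcal{N}(u)}P^*_{u,\theta}(v)\,|h(u,v;\theta)|$. Then with probability at least $1-\rho$, simultaneously for all $\theta\in\Theta$, $$\mathcal{L}_{ideal}(u;\theta)\le\widetilde{\mathcal{L}}_{DRO\_smooth}(u;\theta)+\mathcal{B}(\alpha,d_u,\rho),\qquad \mathcal{B}(\alpha,d_u,\rho)=\frac{(d_u+\sqrt{d_u})\,e^{2\sqrt{d_u}/\alpha}}{d_u-1+e^{2\sqrt{d_u}/\alpha}}\sqrt{\frac12\log\frac{|\Theta|}{\rho}}.$$
   Context: Setting: a user–item bipartite graph in which every node has degree at least 1; $\mathcal{N}(u)$ is the neighbor set of $u$, $d_u=|\mathcal{N}(u)|$, $d_v$ the degree of $v$, and $P_u$ is the uniform distribution on $\mathcal{N}(u)$. $g(u,v;\theta)=-\frac{\mathrm{E}_u^\top\mathrm{E}_v}{\sqrt{d_u}\sqrt{d_v}}$, where $\mathrm{E}_w\in\mathbb{R}^c$ is the embedding of node $w$ under model $\theta$. $D_{KL}(P,Q)=\sum_v P(v)\log\frac{P(v)}{Q(v)}$. *)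

(* Defs.v *)
From HB Require Import structures.
From mathcomp Require Import all_boot all_order all_algebra.
From mathcomp Require Import all_classical all_reals all_analysis.
Set Implicit Arguments. Unset Strict Implicit. Unset Printing Implicit Defensive.
Import Order.TTheory GRing.Theory Num.Theory.
Local Open Scope classical_set_scope.
Local Open Scope ring_scope.

(* Users : finType, Items : finType, [adj x y] = user x and item y are linked.
   Nodes are [Users + Items]; edges only go between users and items. *)
Definition bedge (Us Is : finType) (adj : Us -> Is -> bool) (a b : (Us + Is)%type) : bool :=
  match a, b with
  | inl x, inr y => adj x y
  | inr y, inl x => adj x y
  | _, _ => false
  end.

Definition nbr (Us Is : finType) (adj : Us -> Is -> bool) (w : (Us + Is)%type)
  : {set (Us + Is)%type} := [set v | bedge adj w v].

Definition deg (Us Is : finType) (adj : Us -> Is -> bool) (w : (Us + Is)%type) : nat :=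
  #|nbr adj w|.

Definition dotr {R : realType} (c : nat) (a b : 'rV[R]_c) : R := \sum_(i < c) a 0 i * b 0 i.
Definition norm2 {R : realType} (c : nat) (a : 'rV[R]_c) : R := Num.sqrt (\sum_(i < c) a 0 i ^+ 2).

Definition gscore {R : realType} (Us Is : finType) (adj : Us -> Is -> bool) (c : nat)
  (E : (Us + Is)%type -> 'rV[R]_c) (u v : (Us + Is)%type) : R :=
  - dotr (E u) (E v) / (Num.sqrt (deg adj u)%:R * Num.sqrt (deg adj v)%:R).

Definition hscore {R : realType} (Us Is : finType) (adj : Us -> Is -> bool) (c : nat)
  (E : (Us + Is)%type -> 'rV[R]_c) (u v : (Us + Is)%type) : R :=
  dotr (E u) (E u) + (deg adj u)%:R * gscore adj E u v.

Definition is_dist_on {R : realType} (V : finType) (A : {set V}) (P : V -> R) : Prop :=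
  (forall v, 0 <= P v) /\ (forall v, v \notin A -> P v = 0) /\ \sum_(v in A) P v = 1.

Definition Punif {R : realType} (Us Is : finType) (adj : Us -> Is -> bool)
  (u v : (Us + Is)%type) : R :=
  if v \in nbr adj u then ((deg adj u)%:R)^-1 else 0.

(* KL divergence D_KL(P,Q) = sum_v P(v) log (P(v)/Q(v)), summed over the support A
   of Q (here Q = P_u > 0 on A); the convention 0 log 0 = 0 holds since ln 0 = 0. *)
Definition KL {R : realType} (V : finType) (A : {set V}) (P Q : V -> R) : R :=
  \sum_(v in A) P v * ln (P v / Q v).

Definition Edist {R : realType} (V : finType) (A : {set V}) (P F : V -> R) : R :=
  \sum_(v in A) P v * F v.

Definition Pstar {R : realType} (Us Is : finType) (adj : Us -> Is -> bool) (c : nat)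
  (E : (Us + Is)%type -> 'rV[R]_c) (alpha : R) (u v : (Us + Is)%type) : R :=
  Punif adj u v * expR (gscore adj E u v / alpha) /
  Edist (nbr adj u) (Punif adj u) (fun w => expR (gscore adj E u w / alpha)).

Definition L_DRO {R : realType} (Us Is : finType) (adj : Us -> Is -> bool) (c : nat)
  (E : (Us + Is)%type -> 'rV[R]_c) (alpha : R) (u : (Us + Is)%type) : R :=
  Edist (nbr adj u) (Pstar adj E alpha u) (hscore adj E u).

Definition KL_ball_maximizer {R : realType} (V : finType) (A : {set V}) (Q : V -> R)
  (eta : R) (F P : V -> R) : Prop :=
  [/\ is_dist_on A P, KL A P Q <= eta &
      forall P', is_dist_on A P' -> KL A P' Q <= eta -> Edist A P' F <= Edist A P F].

(* bounded-difference constant max_{v in N(u)} P*(v) |h(u,v)| (all terms are >= 0) *)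
Definition bd_const {R : realType} (Us Is : finType) (adj : Us -> Is -> bool) (c : nat)
  (E : (Us + Is)%type -> 'rV[R]_c) (alpha : R) (u : (Us + Is)%type) : R :=
  \big[Num.max/0]_(v in nbr adj u) (Pstar adj E alpha u v * `|hscore adj E u v|).

Definition Bbound {R : realType} (alpha : R) (d : nat) (rho : R) (card : nat) : R :=
  ((d%:R + Num.sqrt d%:R) * expR (2 * Num.sqrt d%:R / alpha) /
   (d%:R - 1 + expR (2 * Num.sqrt d%:R / alpha))) *
  Num.sqrt (2^-1 * ln (card%:R / rho)).

(* mutual independence of X_0,...,X_{n-1} : T -> S (product rule on all measurable
   rectangles; subfamilies are obtained by taking A i = setT) *)
Definition mutually_independent (dT dS : measure_display) (T : measurableType dT)
  (S : measurableType dS) {R : realType} (P : probability T R) (n : nat)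
  (X : 'I_n -> T -> S) : Prop :=
  (forall i, measurable_fun setT (X i)) /\
  forall A : 'I_n -> set S, (forall i, measurable (A i)) ->
    P (\bigcap_(i in [set: 'I_n]) (X i @^-1` A i)) =
    (\prod_(i < n) P (X i @^-1` A i))%E.

Definition rvec (T S : Type) (n : nat) (X : 'I_n -> T -> S) (w : T) : n.-tuple S :=
  [tuple X i w | i < n].

Definition bounded_differences {R : realType} (S : Type) (n : nat)
  (f : n.-tuple S -> R) (cst : R) : Prop :=
  forall (i : 'I_n) (x y : n.-tuple S),
    (forall j, j != i -> tnth x j = tnth y j) -> `|f x - f y| <= cst.

(* Main.v *)
Require Import Defs.
From HB Require Import structures.
From mathcomp Require Import all_boot all_order all_algebra.
From mathcomp Require Import all_classical all_reals all_analysis.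
From mathcomp Require Import measurable_realfun ring lra.
Import Order.TTheory GRing.Theory Num.Theory.
Import numFieldNormedType.Exports.
Local Open Scope classical_set_scope.
Local Open Scope ring_scope.

(* Maximality of P* over the KL ball gives L_ideal <= L_DRO, so only the lower
   deviation of the estimator has to be controlled. By McDiarmid's inequality
   each estimator falls below its mean by t with probability at most
   exp(-2 t^2 / (d b^2)) as soon as its bounded difference constant is at most
   b; a union bound over Theta concludes, t = Bbound being chosen so that this
   probability is rho / |Theta|. The constant comes from |g| <= 1 / sqrt d,
   whence |h| <= 1 + sqrt d, and from the fact that two weights exp(g / alpha)
   differ by a factor at most q = exp(2 sqrt d / alpha), whence
   P* <= q / (d - 1 + q).

   McDiarmid's inequality follows from Chernoff's bound and an estimate of the
   exponential moments by induction on the number of variables: freezing the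
   first variable, the induction hypothesis applies to the others, and the
   conditional expectation given the first variable oscillates by at most c, so
   that Hoeffding's lemma applies to it. *)

Set Implicit Arguments.
Unset Strict Implicit.

(** * Hoeffding's lemma *)

(** Mean value theorem on [0, h]. Two applications pass from the sign of a second derivative to that
    of the function. *)
Lemma ge0_is_derive_ge0 (R : realType) (f f' : R -> R) (h : R) :
  (forall x : R, 0 <= x -> is_derive x (1 : R) f (f' x)) ->
  (forall x : R, 0 <= x -> 0 <= f' x) -> f 0 = 0 -> 0 <= h -> 0 <= f h.
Proof.
move=> df f'0 f0; rewrite le_eqVlt => /predU1P[<-|h0]; first by rewrite f0.
have [] := @MVT R f f' 0 h h0.
- by move=> x /[!in_itv]/= /andP[/ltW x0 _]; exact: df.
- apply: continuous_in_subspaceT => x /[!inE]/= /[!in_itv]/= /andP[x0 _].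
  have dfx := df x x0.
  by apply: differentiable_continuous; apply/derivable1_diffP.
move=> x /[!in_itv]/= /andP[/ltW x0 _]; rewrite f0 !subr0 => ->.
by apply: mulr_ge0; [exact: f'0|exact: ltW].
Qed.

(* The logarithm of the quotient of the right side by the left one vanishes to
   first order at 0 and has second derivative 1/4 - q (1 - q) >= 0, where q is
   the tilted parameter. *)
Lemma bernoulli_mgf_le (R : realType) (p h : R) : 0 <= p <= 1 -> 0 <= h ->
  1 - p + p * expR h <= expR (h * p + h ^+ 2 / 8).
Proof.
move=> /andP[p0 p1] h0.
pose D (x : R) := 1 - p + p * expR x.
have D0 x : 0 < D x.
  have := expR_gt0 x; rewrite /D => e0.
  have [->|pn1] := eqVneq p 1; first by lra.
  have : p < 1 by rewrite lt_neqAle pn1.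
  have : 0 <= p * expR x by rewrite mulr_ge0 // ltW.
  by lra.
have dD (x : R) : is_derive x (1 : R) D (p * expR x).
  apply: is_derive_eq.
  by rewrite /GRing.scale/=; ring.
pose q x := p * expR x / D x.
have dq (x : R) : is_derive x (1 : R) q (q x * (1 - q x)).
  have D0' : D x != 0 by rewrite gt_eqF.
  have dV := is_deriveV D0' (dD x).
  rewrite /q; apply: is_derive_eq.
  by rewrite /GRing.scale/=; field.
pose psi (x : R) := x * p + x ^+ 2 / 8 - ln (D x).
have dpsi (x : R) : is_derive x (1 : R) psi (p + x / 4 - q x).
  have dlD := is_derive1_comp (is_derive1_ln (D0 x)) (dD x).
  rewrite /psi; apply: is_derive_eq.
  rewrite /GRing.scale/= /q; field.
  by rewrite gt_eqF.
suff : 0 <= psi h by rewrite /psi subr_ge0 -ler_expR lnK ?posrE.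
apply: (@ge0_is_derive_ge0 _ psi _ _ (fun x _ => dpsi x)) => // [x x0|].
  have d1 (y : R) : is_derive y (1 : R) (fun x => p + x / 4 - q x)
      (1 / 4 - q y * (1 - q y)).
    by apply: is_derive_eq; rewrite /GRing.scale/=; field.
  apply: (@ge0_is_derive_ge0 _ _ _ _ (fun x _ => d1 x)) => // [y _|].
    have -> : 1 / 4 - q y * (1 - q y) = (q y - 1 / 2) ^+ 2 by field.
    exact: sqr_ge0.
  by rewrite /q /D expR0 mulr1 subrK divr1 mul0r addr0 subrr.
by rewrite /psi /D expR0 mulr1 subrK ln1; ring.
Qed.

Lemma bounded_fun_integrable d (T : measurableType d) (R : realType)
    (P : probability T R) (Z : T -> R) (K : R) :
  measurable_fun setT Z -> (forall w, `|Z w| <= K) ->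
  P.-integrable setT (EFin \o Z).
Proof.
move=> mZ ZK; apply: measurable_bounded_integrable => //.
  exact: le_lt_trans (probability_le1 P measurableT) (ltry 1).
exists K; split; first exact: num_real.
by move=> x Kx w _ /=; exact: le_trans (ZK w) (ltW Kx).
Qed.

Lemma Rintegral_prob_cst d (T : measurableType d) (R : realType)
    (P : probability T R) (k : R) : \int[P]_w k = k.
Proof. by rewrite Rintegral_cst//= probability_setT mulr1. Qed.

Lemma normr_Rintegral_le d (T : measurableType d) (R : realType)
    (P : probability T R) (Z : T -> R) (K : R) :
  measurable_fun setT Z -> (forall w, `|Z w| <= K) -> `|\int[P]_w Z w| <= K.
Proof.
move=> mZ ZK; have iZ := bounded_fun_integrable P mZ ZK.
rewrite (le_trans (le_normr_Rintegral _ iZ))//.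
rewrite -[leRHS](Rintegral_prob_cst P) le_Rintegral//.
  exact: integrable_norm iZ.
exact: (@bounded_fun_integrable _ _ _ P _ `|K|).
Qed.

(** Measurable types are pointed, so bounded oscillation bounds Z around its value at [point]. *)
Lemma osc_integrable d (T : measurableType d) (R : realType)
    (P : probability T R) (Z : T -> R) (c : R) :
  measurable_fun setT Z -> (forall w w', `|Z w - Z w'| <= c) ->
  P.-integrable setT (EFin \o Z).
Proof.
move=> mZ Zc.
apply: (@bounded_fun_integrable _ _ _ _ _ (c + `|Z point|)) => // w.
by rewrite -[Z w](subrK (Z point)) (le_trans (ler_normD _ _))// lerD2r.
Qed.

(** Z takes its values in an interval [a, a + c], on which the exponential lies below its chord.
    Integrating the chord leaves the exponential moment of a two-point variable with the same mean,
    which [bernoulli_mgf_le] bounds. *)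
Lemma hoeffding_lemma d (T : measurableType d) (R : realType)
    (P : probability T R) (Z : T -> R) (c s : R) :
  measurable_fun setT Z -> (forall w w', `|Z w - Z w'| <= c) -> 0 <= s ->
  \int[P]_w expR (s * Z w) <= expR (s * \int[P]_w Z w + s ^+ 2 * c ^+ 2 / 8).
Proof.
move=> mZ Zc s0.
have iZ := osc_integrable P mZ Zc.
have c0 : 0 <= c by apply: le_trans (Zc point point).
have Zlb : has_lbound (range Z).
  exists (Z point - c) => _ [w _ <-].
  by have := Zc point w; rewrite ler_norml; lra.
pose a := inf (range Z).
have aZ w : a <= Z w by apply: ge_inf => //; exists w.
have Za w : Z w <= a + c.
  rewrite -lerBlDr; apply: lb_le_inf; first by exists (Z point), point.
  by move=> _ [w' _ <-]; have := Zc w w'; rewrite ler_norml; lra.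
have imZ : a <= \int[P]_w Z w <= a + c.
  rewrite -[X in X <= _ <= _](Rintegral_prob_cst P a).
  rewrite -[X in _ <= _ <= X](Rintegral_prob_cst P (a + c)).
  have icst k : P.-integrable setT (EFin \o (fun=> k : R)).
    exact: (@bounded_fun_integrable _ _ _ _ _ `|k|).
  by rewrite !le_Rintegral.
(* For c = 0, Z is constant; otherwise one may divide by c. *)
have [c00|cn0] := eqVneq c 0.
  have ZE w : Z w = a by apply/eqP; rewrite eq_le aZ -[a]addr0 -c00 Za.
  under eq_Rintegral do rewrite ZE.
  rewrite Rintegral_prob_cst ler_expR c00 expr0n mulr0 mul0r addr0 ler_wpM2l//.
  by case/andP: imZ.
have cp : 0 < c by rewrite lt_neqAle eq_sym cn0.
pose h := s * c.
have h0 : 0 <= h by rewrite mulr_ge0.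
(* Slope of the chord of x |-> exp(s x) over [a, a + c]. *)
pose b := expR (s * a) * (expR h - 1) / c.
have chord w : expR (s * Z w) <= expR (s * a) - b * a + b * Z w.
  pose p := (Z w - a) / c.
  have p01 : 0 <= p <= 1.
    rewrite divr_ge0 ?subr_ge0//= ler_pdivrMr// mul1r.
    by have := Za w; lra.
  have -> : s * Z w = s * a + h * p by rewrite /h /p; field.
  have -> : expR (s * a) - b * a + b * Z w =
      expR (s * a) * (1 - p + p * expR h).
    by rewrite /b /p; field.
  rewrite expRD ler_pM2l ?expR_gt0//.
  (* Convexity, from the tangent of expR at h * p evaluated at 0 and at h. *)
  have e0 := expR_gt0 (h * p).
  have e1 : 1 - h * p <= expR (- (h * p)) by exact: expR_ge1Dx.
  have e2 : 1 + h * (1 - p) <= expR (h * (1 - p)) by exact: expR_ge1Dx.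
  have e3 : expR (h * p) * expR (- (h * p)) = 1 by rewrite -expRD subrr expR0.
  have e4 : expR (h * p) * expR (h * (1 - p)) = expR h.
    by rewrite -expRD; congr expR; ring.
  case/andP: p01 => p0 p1.
  have q0 : 0 <= 1 - p by rewrite subr_ge0.
  rewrite -{1}e3 -e4.
  have := lerD (ler_wpM2l q0 e1) (ler_wpM2l p0 e2) => E.
  have := ler_wpM2l (ltW e0) E.
  have -> : (1 - p) * (1 - h * p) + p * (1 + h * (1 - p)) = 1 by ring.
  rewrite mulr1 => /le_trans; apply; rewrite mulrDr lerD//.
    by rewrite mulrCA e3 mulr1.
  by rewrite mulrCA.
have mexp : measurable_fun setT (fun w => expR (s * Z w)).
  by apply: measurableT_comp => //; exact: measurable_funM.
have iexp : P.-integrable setT (EFin \o (fun w => expR (s * Z w))).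
  apply: (@bounded_fun_integrable _ _ _ _ _ (expR (s * (a + c)))) => // w.
  by rewrite ger0_norm ?expR_ge0// ler_expR ler_wpM2l.
apply: (@le_trans _ _ (expR (s * a) - b * a + b * \int[P]_w Z w)).
  have icst (k : R) : P.-integrable setT (EFin \o (fun=> k)).
    exact: (@bounded_fun_integrable _ _ _ _ _ `|k|).
  have ibZ : P.-integrable setT (EFin \o (fun w => b * Z w)).
    by have := integrableZl measurableT b iZ; apply: eq_integrable.
  rewrite -RintegralZl// -[X in X + _](Rintegral_prob_cst P) -RintegralD//.
  apply: le_Rintegral => //.
  have := integrableD measurableT (icst (expR (s * a) - b * a)) ibZ.
  exact: eq_integrable.
(* The relative position of the mean in [a, a + c] is the Bernoulli parameter. *)
pose p := (\int[P]_w Z w - a) / c.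
have p01 : 0 <= p <= 1.
  case/andP: imZ => ? ?; rewrite divr_ge0 ?subr_ge0//= ler_pdivrMr// mul1r.
  by lra.
have -> : s * \int[P]_w Z w + s ^+ 2 * c ^+ 2 / 8 =
    s * a + (h * p + h ^+ 2 / 8).
  by rewrite /h /p; field.
have -> : expR (s * a) - b * a + b * \int[P]_w Z w =
    expR (s * a) * (1 - p + p * expR h).
  by rewrite /b /p; field.
by rewrite expRD ler_pM2l ?expR_gt0// bernoulli_mgf_le.
Qed.

(** * Fubini's theorem for independent variables *)

Lemma Fubini_Rintegral d1 d2 (T1 : measurableType d1) (T2 : measurableType d2)
    (R : realType) (P : probability T1 R) (Q : probability T2 R)
    (F : T1 * T2 -> R) (K : R) :
  measurable_fun setT F -> (forall z, `|F z| <= K) ->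
  measurable_fun setT (fun x => \int[Q]_y F (x, y)) /\
  (\int[P \x Q]_z (F z)%:E = \int[P]_x (\int[Q]_y F (x, y))%:E)%E.
Proof.
move=> mF FK.
have iF : (P \x Q)%E.-integrable setT (EFin \o F).
  exact: (@bounded_fun_integrable _ _ _ (P \x Q)%E _ K).
have inner x : (\int[Q]_y F (x, y))%:E = (\int[Q]_y (F (x, y))%:E)%E.
  rewrite fineK//; apply: integrable_fin_num => //.
  apply: (@bounded_fun_integrable _ _ _ Q (fun y => F (x, y)) K) => //.
  by apply: measurableT_comp => //; exact: pair1_measurable.
split.
  apply/measurable_EFinP; have := measurable_fubini_F iF.
  rewrite /fubini_F; under eq_fun do rewrite /= -inner; exact.
rewrite -integral12_prod_meas1//; apply: eq_integral => x _.
by rewrite /fubini_F /= inner.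
Qed.

(** The law of (X, Y) is the product of the two laws; Fubini applies to the product, and each law is
    then pulled back to T. *)
Lemma independent_Fubini d d1 d2 (T : measurableType d)
    (T1 : measurableType d1) (T2 : measurableType d2)
    (R : realType) (P : probability T R) (X : T -> T1) (Y : T -> T2)
    (F : T1 * T2 -> R) (K : R) :
  measurable_fun setT X -> measurable_fun setT Y ->
  (forall A B, measurable A -> measurable B ->
    P (X @^-1` A `&` Y @^-1` B) = (P (X @^-1` A) * P (Y @^-1` B))%E) ->
  measurable_fun setT F -> (forall z, `|F z| <= K) ->
  P.-integrable setT (EFin \o (fun w => \int[P]_w' F (X w, Y w'))) /\
  \int[P]_w F (X w, Y w) = \int[P]_w \int[P]_w' F (X w, Y w').
Proof.
move=> mX mY XY mF FK.
pose X' : {mfun T >-> T1} := HB.pack X (isMeasurableFun.Build _ _ _ _ _ mX).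
pose Y' : {mfun T >-> T2} := HB.pack Y (isMeasurableFun.Build _ _ _ _ _ mY).
have mXY : measurable_fun setT (fun w => (X w, Y w)).
  exact: measurable_fun_pair.
pose Z : {mfun T >-> (T1 * T2)%type} :=
  HB.pack (fun w => (X w, Y w)) (isMeasurableFun.Build _ _ _ _ _ mXY).
have [mG EF] :=
  Fubini_Rintegral (distribution P X') (distribution P Y') mF FK.
have inner x : \int[distribution P Y']_y F (x, y) = \int[P]_w' F (x, Y w').
  rewrite /Rintegral; congr fine.
  have mFx : measurable_fun setT (fun y => F (x, y)).
    by apply: measurableT_comp => //; exact: pair1_measurable.
  rewrite integral_pushforward//; first exact/measurable_EFinP.
  apply: (@bounded_fun_integrable _ _ _ P (fun w => F (x, Y w)) K) => //.
  exact: (measurableT_comp mFx mY).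
have innerE : (fun x => \int[distribution P Y']_y F (x, y)) =
    (fun x => \int[P]_w' F (x, Y w')) by apply/funext => x; exact: inner.
rewrite innerE in mG.
have iG : P.-integrable setT (EFin \o (fun w => \int[P]_w' F (X w, Y w'))).
  apply: (@bounded_fun_integrable _ _ _ P _ K).
    exact: (measurableT_comp mG mX).
  move=> w; apply: normr_Rintegral_le => //.
  by apply: (measurableT_comp mF); exact: measurable_fun_pair.
split => //.
rewrite {1 2}/Rintegral; congr fine.
transitivity (\int[distribution P Z]_z (F z)%:E)%E.
  rewrite integral_pushforward//; first exact/measurable_EFinP.
  apply: (@bounded_fun_integrable _ _ _ P (fun w => F (X w, Y w)) K) => //.
  exact: (measurableT_comp mF mXY).
(* Both measures agree on rectangles by [XY], hence everywhere. *)
transitivity (\int[distribution P X' \x distribution P Y']_z (F z)%:E)%E.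
  apply: eq_measure_integral => A mA _; apply/esym.
  exact: (@product_measure_unique _ _ _ _ _ (distribution P X')
    (distribution P Y') (distribution P Z) XY A mA).
rewrite EF (eq_integral (fun x => (\int[P]_w' F (x, Y w'))%:E)); last first.
  by move=> x _; rewrite -inner.
by rewrite integral_pushforward//; exact/measurable_EFinP.
Qed.

(** * Independence of the first variable and the vector of the others *)

Lemma tnth_rvec (T S : Type) n (X : 'I_n -> T -> S) w i :
  tnth (rvec X w) i = X i w.
Proof. exact: tnth_mktuple. Qed.

Lemma rvecS (T S : Type) n (X : 'I_n.+1 -> T -> S) w :
  rvec X w = [tuple of X ord0 w :: rvec (fun i => X (lift ord0 i)) w].
Proof.
apply: eq_from_tnth => i; rewrite tnth_rvec.
by case: (unliftP ord0 i) => [j|] ->; rewrite ?tnthS ?tnth_rvec// tnth0.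
Qed.

Lemma measurable_rvec dT dS (T : measurableType dT) (S : measurableType dS) n
    (X : 'I_n -> T -> S) :
  (forall i, measurable_fun setT (X i)) -> measurable_fun setT (rvec X).
Proof.
move=> mX; apply/measurable_fun_tnthP => i.
by rewrite (_ : _ \o _ = X i)//; apply/funext => w; exact: tnth_rvec.
Qed.

Lemma bigcap_ord_recl (T : Type) n (F : 'I_n.+1 -> set T) :
  \bigcap_(i in [set: 'I_n.+1]) F i =
  F ord0 `&` \bigcap_(i in [set: 'I_n]) F (lift ord0 i).
Proof.
apply/seteqP; split=> [w FT|w [F0 FS] i _]; first by split=> [|i _]; exact: FT.
by case: (unliftP ord0 i) => [j|] ->//; exact: FS.
Qed.

Section independent_head_tail.
Context dT dS (T : measurableType dT) (S : measurableType dS) (R : realType)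
  (P : probability T R) (n : nat) (X : 'I_n.+1 -> T -> S).
Hypothesis indX : mutually_independent P X.

Let Y (i : 'I_n) := X (lift ord0 i).

Let head_rect (A : set S) (C : 'I_n -> set S) : measurable A ->
  (forall i, measurable (C i)) ->
  (P (X ord0 @^-1` A `&` \bigcap_(i in [set: 'I_n]) Y i @^-1` C i) =
   P (X ord0 @^-1` A) * \prod_(i < n) P (Y i @^-1` C i))%E.
Proof.
move=> mA mC; have [_] := indX.
move/(_ (fun i => if unlift ord0 i is Some j then C j else A)).
rewrite bigcap_ord_recl big_ord_recl unlift_none.
under eq_bigcapr do rewrite liftK.
under eq_bigr do rewrite liftK.
by apply => i; case: unliftP.
Qed.

Lemma independent_tail : mutually_independent P Y.
Proof.
split=> [i|A mA]; first by have [mX _] := indX; exact: mX.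
have := head_rect measurableT mA.
by rewrite preimage_setT setTI probability_setT mul1e.
Qed.

(** Provides the hypothesis of [independent_Fubini]: B is an arbitrary measurable set of tuples,
    whereas mutual independence speaks of rectangles only. *)
Lemma independent_head_tail (A : set S) (B : set (n.-tuple S)) :
  measurable A -> measurable B ->
  P (X ord0 @^-1` A `&` rvec Y @^-1` B) =
  (P (X ord0 @^-1` A) * P (rvec Y @^-1` B))%E.
Proof.
move=> mA mB; have [mX _] := indX.
have mYC C i : measurable C -> measurable (Y i @^-1` C).
  by move=> mC; rewrite -[_ @^-1` _]setTI; exact: mX.
pose G := [set E | exists2 C : 'I_n -> set S, (forall i, measurable (C i)) &
  E = \bigcap_(i in [set: 'I_n]) Y i @^-1` C i].
have mX0A : measurable (X ord0 @^-1` A) by rewrite -[_ @^-1` _]setTI; exact: mX.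
(* [mscale] takes a nonnegative real factor, whence [fine]. *)
have P0 : (0 <= fine (P (X ord0 @^-1` A))) by exact: fine_ge0.
have PE : P (X ord0 @^-1` A) = (fine (P (X ord0 @^-1` A)))%:E.
  by rewrite fineK// fin_num_measure.
have GB : <<s G >> (rvec Y @^-1` B).
  have : g_sigma_preimage Y (rvec Y @^-1` B).
    have -> : g_sigma_preimage Y =
        g_sigma_preimage (fun i => (fun x : n.-tuple S => tnth x i) \o rvec Y).
      congr (g_sigma_preimage _); apply/funext => i; apply/funext => w /=.
      by rewrite tnth_rvec.
    by rewrite g_sigma_preimage_comp; exists B; rewrite ?setTI.
  apply: sub_smallest2r; first exact: smallest_sigma_algebra.
  move=> E; rewrite -bigcup_seq => -[i _].
  rewrite /preimage_set_system => -[C mC <-].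
  (* A constraint on the single variable [Y i] is a rectangle whose other sides are full. *)
  exists (fun j => if j == i then C else setT).
    by move=> j; case: ifP.
  rewrite setTI; apply/seteqP; split => [w YC j _/=|w /(_ i I)]; last first.
    by rewrite /= eqxx.
  by case: eqP => // ->.
have mE E : mscale (NngNum P0) P E = (P (X ord0 @^-1` A) * P E)%E.
  by rewrite [in RHS]PE.
(* In the event E = rvec Y @^-1` B both sides are measures, and they agree on
   the pi-system G, which generates the sigma-algebra of rvec Y. *)
rewrite -mE setIC.
apply: (@g_sigma_algebra_measure_unique _ _ _ G _ (fun=> setT) _ _
  (mrestr P mX0A) _ _ _ _ _ GB).
- move=> _ [C mC ->]; apply: fin_bigcap_measurable => // i _; exact: mYC.
- move=> _; exists (fun=> setT) => //.
  by apply/seteqP; split.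
- by rewrite bigcup_const.
- move=> _ _ [C mC ->] [C' mC' ->]; exists (fun i => C i `&` C' i).
    by move=> i; exact: measurableI.
  by rewrite -bigcapI.
- move=> _ [C mC ->]; apply: etrans (esym (mE _)).
  rewrite /= /mrestr setIC head_rect//; congr (_ * _)%E.
  by case: independent_tail => _ ->.
- by move=> _; rewrite /= /mrestr setTI PE ltry.
Qed.

End independent_head_tail.

(** * McDiarmid's inequality *)

Lemma bounded_differences_cons (R : realType) (S : Type) n
    (f : n.+1.-tuple S -> R) (c : R) (x : S) :
  bounded_differences f c ->
  bounded_differences (fun y : n.-tuple S => f [tuple of x :: y]) c.
Proof.
move=> fc i y z yz; apply: (fc (lift ord0 i)) => j.
case: (unliftP ord0 j) => [k ->|->]; last by rewrite !tnth0.
by rewrite (inj_eq lift_inj) !tnthS => /yz.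
Qed.

Lemma bounded_differences_head (R : realType) (S : Type) n
    (f : n.+1.-tuple S -> R) (c : R) (x x' : S) (y : n.-tuple S) :
  bounded_differences f c -> `|f [tuple of x :: y] - f [tuple of x' :: y]| <= c.
Proof.
move=> /(_ ord0); apply => j.
by case: (unliftP ord0 j) => [k ->|->]; rewrite ?eqxx// !tnthS.
Qed.

(** Coordinates are exchanged one at a time, at cost c each. The resulting boundedness gives
    integrability below. *)
Lemma bounded_differences_osc (R : realType) (S : Type) n
    (f : n.-tuple S -> R) (c : R) :
  bounded_differences f c -> forall x y, `|f x - f y| <= n%:R * c.
Proof.
elim: n f => [|n IH] f fc x y.
  by rewrite (tuple0 x) (tuple0 y) subrr normr0 mul0r.
case/tupleP: x => x0 x; case/tupleP: y => y0 y.
rewrite -[f _](subrK (f [tuple of y0 :: x])) -addrA.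
rewrite (le_trans (ler_normD _ _))// -natr1 mulrDl mul1r [leRHS]addrC.
rewrite lerD//; first exact: bounded_differences_head.
exact: (IH (fun z => f [tuple of y0 :: z]) (bounded_differences_cons _ fc)).
Qed.

Lemma mgf_bounded_differences dT dS (T : measurableType dT)
    (S : measurableType dS) (R : realType) (P : probability T R) n
    (X : 'I_n -> T -> S) (f : n.-tuple S -> R) (c s : R) :
  mutually_independent P X -> measurable_fun setT f ->
  bounded_differences f c -> 0 <= s ->
  \int[P]_w expR (s * f (rvec X w)) <=
  expR (s * \int[P]_w f (rvec X w) + n%:R * (s ^+ 2 * c ^+ 2 / 8)).
Proof.
move=> + + + s0; elim: n X f => [|n IH] X f indX mf fc.
  have rvecE w : rvec X w = [tuple] by rewrite tuple0.
  under eq_Rintegral do rewrite rvecE.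
  under [in leRHS]eq_Rintegral do rewrite rvecE.
  by rewrite !Rintegral_prob_cst mul0r addr0.
have [mX _] := indX.
pose Y i := X (lift ord0 i).
have mY : measurable_fun setT (rvec Y).
  by apply: measurable_rvec => i; exact: mX.
pose F (z : S * n.-tuple S) := f [tuple of z.1 :: z.2].
have mF : measurable_fun setT F.
  by apply: measurableT_comp => //; apply: measurable_cons.
pose x0 : n.+1.-tuple S := rvec X point.
pose K := n.+1%:R * c + `|f x0|.
have fK x : `|f x| <= K.
  rewrite -[f x](subrK (f x0)) (le_trans (ler_normD _ _))// lerD2r.
  exact: bounded_differences_osc.
have FubF G K' := @independent_Fubini _ _ _ _ _ _ _ P (X ord0) (rvec Y) G K'
  (mX ord0) mY (independent_head_tail indX).
have eF : measurable_fun setT (fun z => expR (s * F z)).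
  by apply: measurableT_comp => //; exact: measurable_funM.
have eK z : `|expR (s * F z)| <= expR (s * K).
  rewrite ger0_norm ?expR_ge0// ler_expR ler_wpM2l//.
  exact: le_trans (ler_norm _) (fK _).
under eq_Rintegral do rewrite rvecS.
have [iE ->] := FubF _ _ eF eK.
under [in leRHS]eq_Rintegral do rewrite rvecS.
have [iG ->] := FubF F K mF (fun z => fK _).
(* The conditional expectation of f given the first variable. *)
pose g w := \int[P]_w' F (X ord0 w, rvec Y w').
set v := s ^+ 2 * c ^+ 2 / 8.
have mg : measurable_fun setT g.
  by apply/measurable_EFinP; exact: measurable_int iG.
have mFx x : measurable_fun setT (fun w' => F (x, rvec Y w')).
  by apply: (measurableT_comp mF); exact: measurable_fun_pair.
have iFx x : P.-integrable setT (EFin \o (fun w' => F (x, rvec Y w'))).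
  apply: (@bounded_fun_integrable _ _ _ P _ K) => [|w]; first exact: mFx.
  exact: fK.
(* The two integrands differ in the first coordinate only. *)
have gc w w' : `|g w - g w'| <= c.
  rewrite /g -RintegralB//.
  apply: (@normr_Rintegral_le _ _ _ P (fun t => _ - _)) => [|t].
    exact: measurable_funB (mFx _) (mFx _).
  exact: bounded_differences_head.
have iexpg : P.-integrable setT (EFin \o (fun w => expR (s * g w))).
  apply: (@bounded_fun_integrable _ _ _ P _ (expR (s * K))).
    by apply: measurableT_comp => //; exact: measurable_funM.
  move=> w; rewrite ger0_norm ?expR_ge0// ler_expR ler_wpM2l//.
  rewrite (le_trans (ler_norm _))//.
  by apply: normr_Rintegral_le => // w'; exact: fK.
(* The induction hypothesis for each frozen value gives a factor exp(n v) independent of that value;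
   Hoeffding's lemma for [g] gives the remaining exp(v). *)
apply: (@le_trans _ _ (\int[P]_w (expR (n%:R * v) * expR (s * g w)))).
  apply: le_Rintegral => //.
    have := integrableZl measurableT (expR (n%:R * v)) iexpg.
    exact: eq_integrable.
  move=> w _; rewrite -expRD addrC.
  apply: (IH Y (fun y => f [tuple of X ord0 w :: y])) => //.
  - exact: independent_tail indX.
  - by apply: measurableT_comp => //; exact: measurable_cons.
  - exact: bounded_differences_cons.
rewrite RintegralZl// -natr1 mulrDl mul1r addrCA expRD ler_pM2l ?expR_gt0//.
exact: hoeffding_lemma.
Qed.

Lemma mcdiarmid dT dS (T : measurableType dT) (S : measurableType dS)
    (R : realType) (P : probability T R) n (X : 'I_n -> T -> S)
    (f : n.-tuple S -> R) (c t : R) :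
  mutually_independent P X -> measurable_fun setT f ->
  bounded_differences f c -> (0 < n)%N -> 0 < c -> 0 < t ->
  (P [set w | \int[P]_w f (rvec X w) + t <= f (rvec X w)]%R <=
    (expR (- (2 * t ^+ 2 / (n%:R * c ^+ 2))))%:E)%E.
Proof.
move=> indX mf fc n0 c0 t0; have [mX _] := indX.
have mfX : measurable_fun setT (fun w => f (rvec X w)).
  by apply: measurableT_comp => //; exact: measurable_rvec.
pose Z : {RV P >-> R} :=
  HB.pack (fun w => f (rvec X w)) (isMeasurableFun.Build _ _ _ _ _ mfX).
set m := \int[P]_w f (rvec X w).
(* The minimizer of - r * t + r ^+ 2 * n%:R * c ^+ 2 / 8. *)
pose r := 4 * t / (n%:R * c ^+ 2).
have n0' : 0 < n%:R :> R by rewrite ltr0n.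
have r0 : 0 < r by rewrite divr_gt0 ?mulr_gt0 ?exprn_gt0.
apply: (le_trans (chernoff Z (m + t) r0)).
rewrite /mmt_gen_fun unlock.
(* Chernoff's bound uses an extended-real integral, finite here since f is bounded. *)
have -> : (\int[P]_w ((expR \o r \o* Z) w)%:E =
    (\int[P]_w expR (r * f (rvec X w)))%:E)%E.
  rewrite fineK; first by apply: eq_integral => w _ /=; rewrite mulrC.
  apply: integrable_fin_num => //.
  pose x0 := rvec X point.
  apply: (@bounded_fun_integrable _ _ _ P _ (expR (r * (n%:R * c + `|f x0|)))).
    by apply: measurableT_comp => //; exact: measurable_funM.
  move=> w; rewrite ger0_norm ?expR_ge0// ler_expR ler_pM2l//.
  rewrite -[f _](subrK (f x0)) lerD ?ler_norm// (le_trans (ler_norm _))//.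
  exact: bounded_differences_osc.
rewrite -EFinM lee_fin.
have mgf := mgf_bounded_differences indX mf fc (ltW r0).
apply: (le_trans (ler_wpM2r (expR_ge0 _) mgf)).
(* For this r the two exponents coincide. *)
rewrite -expRD ler_expR -/m le_eqVlt; apply/orP; left; apply/eqP.
by rewrite /r; field; rewrite !gt_eqF.
Qed.

(** * Bounds on the scores and on the weights of P* *)

Lemma norm2_eq1 (R : realType) (c : nat) (a : 'rV[R]_c) :
  norm2 a = 1 -> \sum_(i < c) a 0 i ^+ 2 = 1.
Proof.
rewrite /norm2 => /(congr1 (fun y => y ^+ 2)).
by rewrite sqr_sqrtr ?expr1n// sumr_ge0// => i _; exact: sqr_ge0.
Qed.

(** Termwise |x y| <= (x^2 + y^2) / 2, and the right sides sum to 1. *)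
Lemma dotr_norm1_le1 (R : realType) (c : nat) (a b : 'rV[R]_c) :
  norm2 a = 1 -> norm2 b = 1 -> `|dotr a b| <= 1.
Proof.
move=> /norm2_eq1 a1 /norm2_eq1 b1.
have step : \sum_(i < c) (a 0 i ^+ 2 + b 0 i ^+ 2) / 2 = 1.
  by rewrite -mulr_suml big_split/= a1 b1; lra.
rewrite ler_norml -step /dotr -sumrN; apply/andP; split; apply: ler_sum => i _.
  by have := sqr_ge0 (a 0 i + b 0 i); rewrite sqrrD; lra.
by have := sqr_ge0 (a 0 i - b 0 i); rewrite sqrrB; lra.
Qed.

Lemma dotr_self_norm1 (R : realType) (c : nat) (a : 'rV[R]_c) :
  norm2 a = 1 -> dotr a a = 1.
Proof. by move=> /norm2_eq1 <-; apply: eq_bigr => i _; rewrite expr2. Qed.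

Section graph_bounds.
Context (R : realType) (Us Is : finType) (adj : Us -> Is -> bool) (c : nat)
  (E : (Us + Is)%type -> 'rV[R]_c) (u : (Us + Is)%type) (alpha : R).
Hypotheses (deg_gt0 : forall w, (0 < deg adj w)%N)
  (E1 : forall w, norm2 (E w) = 1) (alpha0 : 0 < alpha).

Local Notation d := ((deg adj u)%:R : R).
Local Notation q := (expR (2 * Num.sqrt d / alpha)).

Lemma sqrt_deg_ge1 w : 1 <= Num.sqrt (deg adj w)%:R :> R.
Proof. by rewrite -[leLHS]sqrtr1 ler_wsqrtr// ler1n. Qed.

Lemma normr_gscore_le v : `|gscore adj E u v| <= (Num.sqrt d)^-1.
Proof.
have su := sqrt_deg_ge1 u; have sv := sqrt_deg_ge1 v.
have su0 := lt_le_trans ltr01 su; have sv0 := lt_le_trans ltr01 sv.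
rewrite /gscore normrM normrN normfV.
rewrite (ger0_norm (mulr_ge0 (sqrtr_ge0 _) (sqrtr_ge0 _))).
rewrite ler_pdivrMr ?mulr_gt0// mulrA mulVf ?gt_eqF// mul1r.
exact: le_trans (dotr_norm1_le1 (E1 u) (E1 v)) sv.
Qed.

Lemma normr_hscore_le v : `|hscore adj E u v| <= 1 + Num.sqrt d.
Proof.
have su0 := lt_le_trans ltr01 (sqrt_deg_ge1 u).
rewrite /hscore dotr_self_norm1// (le_trans (ler_normD _ _))// normr1 lerD2l.
rewrite normrM ger0_norm// (le_trans (ler_wpM2l _ (normr_gscore_le v)))//.
by rewrite -{1}(sqr_sqrtr (ler0n R (deg adj u))) expr2 mulfK ?gt_eqF.
Qed.

(** Once 1/d cancels, P*(v) is the weight of v over the sum of all weights, and each of the d - 1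
    others is at least 1/q times that of v. *)
Lemma Pstar_le v : v \in nbr adj u -> Pstar adj E alpha u v <= q / (d - 1 + q).
Proof.
move=> vu; set g := gscore adj E u.
have d0 : 0 < d by rewrite ltr0n.
have d1 : 0 <= d - 1 by rewrite subr_ge0 ler1n.
have q0 := expR_gt0 (2 * Num.sqrt d / alpha).
have su := sqrt_deg_ge1 u; have su0 := lt_le_trans ltr01 su.
(* The bound 1 / sqrt d is relaxed to sqrt d, which is what the exponent of q expects. *)
have gs w : `|g w| <= Num.sqrt d.
  by apply: le_trans (normr_gscore_le w) (le_trans _ su); rewrite invf_le1.
have ratio w : expR (g v / alpha) <= q * expR (g w / alpha).
  rewrite -expRD ler_expR -mulrDl ler_pM2r ?invr_gt0//.
  by have := gs v; have := gs w; rewrite !ler_norml; lra.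
have ev := expR_gt0 (g v / alpha).
have EE : Edist (nbr adj u) (Punif adj u) (fun w => expR (g w / alpha)) =
    d^-1 * \sum_(w in nbr adj u) expR (g w / alpha).
  by rewrite mulr_sumr; apply: eq_bigr => w wu; rewrite /Punif wu.
have Sge : (d - 1 + q) * expR (g v / alpha) <=
    q * \sum_(w in nbr adj u) expR (g w / alpha).
  have : \sum_(w in nbr adj u) expR (g v / alpha) = d * expR (g v / alpha).
    by rewrite sumr_const mulr_natl.
  rewrite (bigD1 v)//= => sumE; rewrite (bigD1 v)//=.
  have -> : (d - 1 + q) * expR (g v / alpha) = q * expR (g v / alpha) +
      (d * expR (g v / alpha) - expR (g v / alpha)) by ring.
  rewrite -sumE (addrC (expR _)) addrK mulrDr lerD2l mulr_sumr.
  by apply: ler_sum => w _; exact: ratio.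
have S0 : 0 < \sum_(w in nbr adj u) expR (g w / alpha).
  by rewrite (bigD1 v)//= ltr_wpDr// sumr_ge0// => w _; exact: expR_ge0.
rewrite /Pstar EE /Punif vu -/(g v) invfM mulrACA invrK mulVf ?gt_eqF// mul1r.
by rewrite ler_pdivrMr// [leRHS]mulrAC ler_pdivlMr ?ltr_wpDl// [leLHS]mulrC.
Qed.

Lemma bd_const_le :
  bd_const adj E alpha u <= (1 + Num.sqrt d) * (q / (d - 1 + q)).
Proof.
have d1 : 0 <= d - 1 by rewrite subr_ge0 ler1n.
have q0 := expR_gt0 (2 * Num.sqrt d / alpha).
(* The maximum starts from 0, so the bound must also be nonnegative. *)
apply: bigmax_le => [|v vu].
  have D0 : 0 <= d - 1 + q by rewrite addr_ge0// ltW.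
  by rewrite mulr_ge0 ?divr_ge0 ?(ltW q0)// addr_ge0 ?sqrtr_ge0.
rewrite mulrC ler_pM ?normr_ge0 ?normr_hscore_le ?Pstar_le//.
rewrite /Pstar /Punif vu divr_ge0 ?mulr_ge0 ?expR_ge0 ?invr_ge0//.
by apply: sumr_ge0 => w wu; rewrite wu mulr_ge0 ?expR_ge0 ?invr_ge0.
Qed.

End graph_bounds.

(** * Union bound and conclusion *)

Lemma Boole_inequality_seq d (T : measurableType d) (R : realType)
    (P : probability T R) (I : Type) (s : seq I) (A : I -> set T) :
  (forall i, measurable (A i)) ->
  (P (\big[setU/set0]_(i <- s) A i) <= \sum_(i <- s) P (A i))%E.
Proof.
move=> mA; elim: s => [|i s IH]; first by rewrite !big_nil measure0.
rewrite !big_cons (le_trans (measureU2 _ _ _))//; last by rewrite leeD2l.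
exact: bigsetU_measurable.
Qed.

Unset Implicit Arguments.

Theorem theorem2 (R : realType)
  (Us Is : finType) (adj : Us -> Is -> bool)
  (Hdeg : forall w : (Us + Is)%type, (0 < deg adj w)%N)
  (u : (Us + Is)%type)
  (eta alpha rho : R) (Heta : 0 < eta) (Halpha : 0 < alpha)
  (Hrho0 : 0 < rho) (Hrho1 : rho < 1)
  (Theta : finType) (c : nat) (E : Theta -> (Us + Is)%type -> 'rV[R]_c)
  (Hnorm : forall th w, norm2 (E th w) = 1)
  (Hopt : forall th, KL_ball_maximizer (nbr adj u) (Punif adj u) eta
             (hscore adj (E th) u) (Pstar adj (E th) alpha u))
  (Pideal : (Us + Is)%type -> R)
  (Hideal : is_dist_on (nbr adj u) Pideal)
  (HidealKL : KL (nbr adj u) Pideal (Punif adj u) <= eta)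
  (dT dS : measure_display) (T : measurableType dT) (S : measurableType dS)
  (P : probability T R)
  (X : 'I_(deg adj u) -> T -> S)
  (Hindep : mutually_independent P X)
  (f : Theta -> (deg adj u).-tuple S -> R)
  (Hfmeas : forall th, measurable_fun setT (f th))
  (Hfexp : forall th, ('E_P[fun w => f th (rvec X w)] = (L_DRO adj (E th) alpha u)%:E)%E)
  (Hfbd : forall th, bounded_differences (f th) (bd_const adj (E th) alpha u)) :
  (P [set w | forall th : Theta,
        (Edist (nbr adj u) Pideal (hscore adj (E th) u)
         <= f th (rvec X w) + Bbound alpha (deg adj u) rho #|Theta|)%R ]
   >= ((1 - rho)%R)%:E)%E.
Proof.
set d := deg adj u.
pose q := expR (2 * Num.sqrt d%:R / alpha) : R.
(* The bound of [bd_const_le], common to all models. *)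
pose b : R := (1 + Num.sqrt d%:R) * (q / (d%:R - 1 + q)).
pose k := (#|Theta|%:R : R).
pose t := Bbound alpha d rho #|Theta|.
have d0 : (0 < d)%N := Hdeg u.
have b0 : 0 < b.
  have D0 : 0 < d%:R - 1 + q by rewrite ltr_wpDl ?expR_gt0// subr_ge0 ler1n.
  by apply: mulr_gt0; [rewrite ltr_pwDl|rewrite divr_gt0 ?expR_gt0].
have fb th : bounded_differences (f th) b.
  by move=> i x y /Hfbd/le_trans; apply; exact: bd_const_le.
have mfX th : measurable_fun setT (fun w => f th (rvec X w)).
  by apply: measurableT_comp => //; apply: measurable_rvec; case: Hindep.
have fE th : \int[P]_w f th (rvec X w) = L_DRO adj (E th) alpha u.
  by rewrite /Rintegral; have := Hfexp th; rewrite unlock => ->.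
pose bad th := [set w | f th (rvec X w) <= L_DRO adj (E th) alpha u - t].
have mbad th : measurable (bad th).
  by rewrite -[bad th]setTI; exact: measurable_fun_ler.
have Pbad th : (P (bad th) <= (rho / k)%:E)%E.
  (* The model [th] itself shows that [Theta] is nonempty; then k >= 1 > rho makes the logarithm,
     hence t, positive. *)
  have k0 : 0 < k by rewrite ltr0n; apply/card_gt0P; exists th.
  have lnk : 0 < ln (k / rho).
    rewrite ln_gt0// ltr_pdivlMr// mul1r (lt_le_trans Hrho1)//.
    by rewrite /k ler1n -(ltr0n R).
  (* From d + sqrt d = sqrt d (1 + sqrt d); the factor sqrt d cancels the d in McDiarmid's
     exponent. *)
  have tE : t = b * Num.sqrt d%:R * Num.sqrt (2^-1 * ln (k / rho)).
    rewrite /t /Bbound /b -/q -/k; congr (_ * _).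
    have := sqr_sqrtr (ler0n R d); rewrite expr2 => sdd.
    by rewrite -{1}sdd; ring.
  have sd0 : 0 < Num.sqrt (d%:R : R) by rewrite sqrtr_gt0 ltr0n.
  have t0 : 0 < t.
    by rewrite tE (mulr_gt0 (mulr_gt0 b0 sd0))// sqrtr_gt0 mulr_gt0.
  (* Applied to -f, since [mcdiarmid] bounds upper deviations. *)
  have := @mcdiarmid _ _ _ _ _ P _ X (fun x => - f th x) b t
    Hindep _ _ d0 b0 t0.
  have -> : - (2 * t ^+ 2 / (d%:R * b ^+ 2)) = - ln (k / rho).
    rewrite tE 2!exprMn !sqr_sqrtr//; last by rewrite mulr_ge0// ltW.
    have cancel (x y z : R) : x != 0 -> y != 0 ->
        - (2 * (x ^+ 2 * y * (2^-1 * z)) / (y * x ^+ 2)) = - z.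
      by move=> x0 y0; field; rewrite x0 y0.
    by apply: cancel; rewrite gt_eqF// ltr0n.
  rewrite expRN lnK ?posrE ?divr_gt0// invf_div.
  have -> : \int[P]_w (- f th (rvec X w)) = - L_DRO adj (E th) alpha u.
    rewrite -fE -[RHS]mulN1r -RintegralZl//.
      by apply: eq_Rintegral => w _; rewrite mulN1r.
    apply: (@osc_integrable _ _ _ P (fun w => f th (rvec X w))
      (d%:R * b)) => // w w'.
    exact: bounded_differences_osc.
  rewrite (_ : [set w | _] = bad th); last first.
    by apply/seteqP; split => w /=; rewrite /bad/=; lra.
  apply; first exact: measurable_funN.
  by move=> i x y xy; rewrite -opprD normrN; exact: fb xy.
pose Bad := \big[setU/set0]_(th : Theta) bad th.
have mBad : measurable Bad by exact: bigsetU_measurable.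
have PBad : (P Bad <= rho%:E)%E.
  rewrite /Bad (le_trans (Boole_inequality_seq P _ mbad))//.
  apply: (@le_trans _ _ (\sum_(th : Theta) (rho / k)%:E)%E).
    exact: lee_sum.
  rewrite sumEFin lee_fin sumr_const -[_ *+ _]mulr_natr -/k.
  (* For empty [Theta] the sum is 0. *)
  have [->|kn0] := eqVneq k 0; first by rewrite mulr0 ltW.
  by rewrite divfK.
set good := [set w | _].
have mgood : measurable good.
  rewrite (_ : good = \bigcap_(th in [set: Theta]) [set w |
    Edist (nbr adj u) Pideal (hscore adj (E th) u) <= f th (rvec X w) + t]).
    apply: fin_bigcap_measurable => // th _; rewrite -[X in measurable X]setTI.
    by apply: measurable_fun_ler => //; exact: measurable_funD.
  by apply/seteqP; split => w /= gw th => [_|]; exact: gw.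
(* If a model fails at w, then f + t < L_ideal <= L_DRO by maximality of P*, so w is bad for that
   model. *)
have BG : ~` Bad `<=` good.
  move=> w /= nB th; rewrite leNgt; apply/negP => lt_w; apply: nB.
  rewrite /Bad -bigcup_seq; exists th; first by rewrite /= mem_index_enum.
  have [_ _ /(_ _ Hideal HidealKL)] := Hopt th.
  by move: lt_w; rewrite /bad/= /t /L_DRO -/d; lra.
apply: (@le_trans _ _ (P (~` Bad))); last first.
  by apply: le_measure; rewrite ?inE//; exact: measurableC.
by rewrite probability_setC// EFinB leeB.
Qed.
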